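(* Let $X$ be an $n$-dimensional Euclidean or Hermitian space with a fixed orthonormal basis $(v_1,\ldots,v_n)$, with associated creation operators $a_{\mathbf{r}}^\dagger$ and annihilation operators $a_{\mathbf{r}}$. Let $\mathbf{i},\mathbf{j},\mathbf{k}\in\mathcal{I}^n$, and partition their indices into the pairwise disjoint increasing multi-indices $$\mathbf{a}=\mathbf{i}\backslash(\mathbf{j}\cup\mathbf{k}),\quad \mathbf{b}=(\mathbf{j}\cap\mathbf{k})\backslash\mathbf{i},\quad \mathbf{c}=\mathbf{i}\cap\mathbf{j}\cap\mathbf{k},\quad \mathbf{d}=(\mathbf{i}\cap\mathbf{j})\backslash\mathbf{k},$$ $$\mathbf{e}=\mathbf{k}\backslash(\mathbf{i}\cup\mathbf{j}),\quad \mathbf{x}=\mathbf{j}\backslash(\mathbf{i}\cup\mathbf{k}),\quad \mathbf{y}=(\mathbf{i}\cap\mathbf{k})\backslash\mathbf{j}.$$ Then $$\llbracket a_{\mathbf{i}}^\dagger,a_{\mathbf{j}}\rrbracket v_{\mathbf{k}}=\delta_{\mathbf{x}\mathbf{y}=\emptyset}\,(\delta_{\mathbf{d}=\emptyset}-\delta_{\mathbf{c}=\emptyset})\,(-1)^{|\mathbf{d}|+|\mathbf{a}\mathbf{b}>\mathbf{d}\mathbf{e}|}\;v_{\overline{\mathbf{a}\mathbf{c}\mathbf{e}}}.$$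
   Context: $X$ is a Euclidean (real inner product) or Hermitian (complex inner product) space of dimension $n$, with product $\langle\cdot,\cdot\rangle$ (conjugate-linear in the first argument in the complex case). $\bigwedge X$ is its exterior algebra with the induced inner product (different grades orthogonal, $\langle x_1\wedge\cdots\wedge x_p,y_1\wedge\cdots\wedge y_p\rangle=\det(\langle x_i,y_j\rangle)$). The left contraction $M\lrcorner N$ is defined by $\langle L,M\lrcorner N\rangle=\langle M\wedge L,N\rangle$ for all $L\in\bigwedge X$. Multi-indices: $\mathcal{I}^n$ is the set of all increasing multi-indices $(i_1,\ldots,i_p)$, $1\le i_1<\cdots<i_p\le n$, $0\le p\le n$ (including $\emptyset$), identified with subsets of $\{1,\ldots,n\}$; $|\mathbf{i}|$ is the number of indices; set operations give increasing multi-indices. $v_{\mathbf{r}}=v_{r_1}\wedge\cdots\wedge v_{r_p}$ for $\mathbf{r}=(r_1,\ldots,r_p)$, $v_\emptyset=1$. Juxtaposition $\mathbf{r}\mathbf{s}$ is (unordered) concatenation, and $\overline{\mathbf{r}}$ is $\mathbf{r}$ reordered increasingly. $|\mathbf{r}>\mathbf{s}|$ is the number of pairs $(i,j)$ with $i\in\mathbf{r}$, $j\in\mathbf{s}$, $i>j$. $\delta_{\mathbf{P}}$ is $1$ if the proposition $\mathbf{P}$ is true and $0$ otherwise. Operators on $\bigwedge X$: $a_{\mathbf{r}}^\dagger(N)=v_{\mathbf{r}}\wedge N$ and $a_{\mathbf{r}}(N)=v_{\mathbf{r}}\lrcorner N$. Supercommutator: $\bigwedge X$ is $\mathbb{Z}_2$-graded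 by even and odd grades; an endomorphism is even (parity 0) if it preserves and odd (parity 1) if it switches parity of multivectors. $\llbracket S,T\rrbracket=ST-(-1)^{st}TS$ for $S,T$ of parities $s,t$. The operators $a_{\mathbf{r}}$ and $a_{\mathbf{r}}^\dagger$ have the parity of $|\mathbf{r}|$. *)

(* Defs.v *)
From HB Require Import structures.
From mathcomp Require Import all_boot all_order all_algebra.
From mathcomp Require Import boolp reals.
From mathcomp Require Import complex.

Set Implicit Arguments.
Unset Strict Implicit.
Unset Printing Implicit Defensive.

Import Order.TTheory GRing.Theory Num.Theory.

Local Open Scope ring_scope.

Variant space_kind := Euclidean | Hermitian.

Definition space_field (R : realType) (k : space_kind) : numFieldType :=
  match k with Euclidean => R | Hermitian => R[i] end.

Definition space_conj (R : realType) (k : space_kind) :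
    {rmorphism space_field R k -> space_field R k} :=
  match k with
  | Euclidean => idfun
  | Hermitian => (Num.conj : {rmorphism R[i] -> R[i]})
  end.
Arguments space_conj : clear implicits.

(* Forms of type {dot U for theta} are linear in their first argument and      *)
(* theta-linear in the second one, whereas the products considered here are    *)
(* conjugate-linear in the first argument: <x, y> := dot y x.                  *)
Definition inner (K : numFieldType) (theta : K -> K) (U : lmodType K)
  (dot : {dot U for theta}) (x y : U) : K := dot y x.

Section ExteriorAlgebra.
Variables (K : numFieldType) (theta : {rmorphism K -> K}).
Variables (X : vectType K) (E : algType K) (iota : {linear X -> E}).

(* Universal property of the exterior algebra, which determines (E, iota) up   *)
(* to a unique isomorphism; the wedge product is the product of the ring E.    *)
Definition is_exterior_algebra : Prop :=
  (forall x : X, iota x * iota x = 0) /\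
  (forall (A : algType K) (f : {linear X -> A}),
    (forall x : X, f x * f x = 0) ->
    exists g : {lrmorphism E -> A},
      (forall x : X, g (iota x) = f x) /\
      (forall h : {lrmorphism E -> A},
        (forall x : X, h (iota x) = f x) -> h =1 g)).

Definition wedge (s : seq X) : E := \prod_(x <- s) iota x.

Definition is_induced_dot (dotX : {dot X for theta})
    (dotE : {dot E for theta}) : Prop :=
  (forall (p q : nat) (x : p.-tuple X) (y : q.-tuple X), p != q ->
    inner dotE (wedge x) (wedge y) = 0) /\
  (forall (p : nat) (x y : p.-tuple X),
    inner dotE (wedge x) (wedge y) =
      \det (\matrix_(i < p, j < p) inner dotX (tnth x i) (tnth y j))).

Definition is_left_contraction (dotE : {dot E for theta})
    (lctr : E -> E -> E) : Prop :=
  forall L M N : E, inner dotE L (lctr M N) = inner dotE (M * L) N.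

(* M is a sum of components of even grade (b = false) or odd grade (b = true), *)
(* a component of grade p being a linear combination of p-fold products.       *)
Definition has_grade_parity (b : bool) (M : E) : Prop :=
  exists (m : nat) (c : 'I_m -> K) (s : 'I_m -> seq X),
    (forall i, odd (size (s i)) = b) /\ M = \sum_(i < m) c i *: wedge (s i).

Definition switches_parity (T : E -> E) : Prop :=
  forall b M, has_grade_parity b M -> has_grade_parity (~~ b) (T M).

(* Meaningful when T either preserves or switches parity. The zero operator    *)
(* does both, but its supercommutators with linear operators vanish anyway.    *)
Definition op_parity (T : E -> E) : nat := `[< switches_parity T >].

Definition supercommutator (S T : E -> E) : E -> E := fun N =>
  S (T N) - (-1) ^+ (op_parity S * op_parity T) *: T (S N).

Variables (n : nat) (v : n.-tuple X).

Definition wedge_index (r : seq 'I_n) : E := wedge [seq tnth v t | t <- r].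

Definition creation (r : seq 'I_n) : E -> E := fun N => wedge_index r * N.

Definition annihilation (lctr : E -> E -> E) (r : seq 'I_n) : E -> E :=
  fun N => lctr (wedge_index r) N.

End ExteriorAlgebra.

(* Increasing multi-indices are subsets of 'I_n, indexed from 0; enum lists    *)
(* the elements of such a subset in increasing order.                          *)
Definition midx (n : nat) (A : {set 'I_n}) : seq 'I_n := enum A.

Definition reorder (n : nat) (s : seq 'I_n) : seq 'I_n :=
  sort (fun i j : 'I_n => (i <= j)%N) s.

Definition num_gt (n : nat) (r s : seq 'I_n) : nat :=
  (\sum_(i <- r) \sum_(j <- s) (j < i))%N.

(* Main.v *)
(* Wedges of basis vectors multiply by v_r ^ v_s = [r, s disjoint] (-1)^|r>s| v_{r u s},
   the sign of sorting a word being (-1) to its number of inversions.  They are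
   orthonormal, and they span the exterior algebra because, by the universal
   property, a subalgebra containing X is everything.  Hence contraction, as the
   adjoint of multiplication, is v_j _| v_k = [j subset of k] (-1)^|j > k\j| v_{k\j}.
   Thus a_i^+ a_j v_k vanishes unless x, y, d are empty, a_j a_i^+ v_k vanishes
   unless x, y, c are empty, and otherwise both are the same signed multiple of
   v_{ace}, up to the factor (-1)^(|i||j|) of the supercommutator; signs are
   compared by means of |r>s| + |s>r| = |r||s| for disjoint r and s. *)
Require Import Defs.
From HB Require Import structures.
From mathcomp Require Import all_boot all_order all_algebra.
From mathcomp Require Import boolp reals zify.

Set Implicit Arguments.
Unset Strict Implicit.
Unset Printing Implicit Defensive.

Import GRing.Theory Num.Theory.

Local Open Scope ring_scope.

(** * Counting inversions between multi-indices *)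

Section NumGt.
Variable n : nat.
Implicit Types (r s t : seq 'I_n) (A B C : {set 'I_n}).

Lemma num_gt_catl r s t : num_gt (r ++ s) t = (num_gt r t + num_gt s t)%N.
Proof. by rewrite /num_gt big_cat. Qed.

Lemma num_gt_catr r s t : num_gt r (s ++ t) = (num_gt r s + num_gt r t)%N.
Proof. by rewrite /num_gt -big_split; apply: eq_bigr => i _; rewrite big_cat. Qed.

Lemma num_gt_perml r s t : perm_eq r s -> num_gt r t = num_gt s t.
Proof. by move=> rs; rewrite /num_gt (perm_big _ rs). Qed.

Lemma num_gt_permr r s t : perm_eq s t -> num_gt r s = num_gt r t.
Proof. by move=> st; apply: eq_bigr => i _; rewrite (perm_big _ st). Qed.

(** Two indices taken from disjoint words are distinct, so each pair is counted by exactly one of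
    the two terms. *)
Lemma num_gt_addC r s : [disjoint r & s] ->
  (num_gt r s + num_gt s r)%N = (size r * size s)%N.
Proof.
move=> rs; rewrite /num_gt [X in (_ + X)%N]exchange_big -big_split /=.
rewrite -sum1_size big_distrl /= big_seq_cond [RHS]big_seq_cond.
apply: eq_bigr => i; rewrite andbT => ir.
rewrite -big_split mul1n -sum1_size big_seq [RHS]big_seq /=.
apply: eq_bigr => j js.
case: (ltngtP i j) => // /val_inj ij.
by move: (disjointFr rs ir); rewrite ij js.
Qed.

(** For a word without repetition, the parity of this number gives the sign of the permutation that
    sorts it. *)
Fixpoint inversions s : nat :=
  if s is t :: s' then (num_gt [:: t] s' + inversions s')%N else 0.

Lemma inversions_cat r s :
  inversions (r ++ s) = (inversions r + inversions s + num_gt r s)%N.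
Proof.
elim: r => [|t r IHr] /=; first by rewrite /num_gt big_nil addn0.
by rewrite IHr num_gt_catr -(cat1s t r) num_gt_catl; lia.
Qed.

Lemma sorted_midx A : sorted (fun i j : 'I_n => i < j)%N (midx A).
Proof.
rewrite /midx /enum_mem -enumT; apply: sorted_filter.
  by move=> ? ? ?; apply: ltn_trans.
by rewrite -(sorted_map (f := val) (e' := ltn)) val_enum_ord iota_ltn_sorted.
Qed.

Lemma inversions_midx A : inversions (midx A) = 0%N.
Proof.
have := sorted_midx A.
elim: (midx A) => //= t s IHs tsP.
rewrite IHs ?(path_sorted tsP) // addn0 /num_gt big_seq1 big_seq big1 // => j js.
have tr : transitive (fun i j : 'I_n => (i < j)%N) by move=> ? ? ?; apply: ltn_trans.
have /allP/(_ j js) tj := order_path_min tr tsP.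
by rewrite ltnNge ltnW.
Qed.

Lemma perm_midxU A B : [disjoint A & B] ->
  perm_eq (midx A ++ midx B) (midx (A :|: B)).
Proof.
move=> AB; apply: uniq_perm; rewrite ?enum_uniq //.
  rewrite cat_uniq !enum_uniq /= andbT; apply/hasPn => i.
  by rewrite !mem_enum => iB; rewrite (disjointFl AB).
by move=> i; rewrite mem_cat !mem_enum inE.
Qed.

Lemma reorder_midx s A : perm_eq s (midx A) -> reorder s = midx A.
Proof.
move=> sA; have leT : transitive (fun i j : 'I_n => (i <= j)%N).
  by move=> ? ? ?; apply: leq_trans.
apply: (sorted_eq leT) => //.
- by move=> i j ij; apply/val_inj/anti_leq.
- by apply: sort_sorted => i j; apply: leq_total.
- by apply: sub_sorted (sorted_midx A) => i j; apply: ltnW.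
by rewrite perm_sort.
Qed.

End NumGt.

Lemma eq_signr (R : pzRingType) (m p : nat) :
  odd m = odd p -> (-1) ^+ m = (-1) ^+ p :> R.
Proof. by move=> mp; rewrite -signr_odd mp signr_odd. Qed.

(** * Wedge products indexed by words *)

Section WedgeIndex.
Variables (K : numFieldType) (X : vectType K) (E : algType K).
Variables (iota : {linear X -> E}) (n : nat) (v : n.-tuple X).
Hypothesis sq0 : forall x, iota x * iota x = 0.
Implicit Types (r s : seq 'I_n) (A B : {set 'I_n}).

Let W r := wedge_index iota v r.
Let V A := W (midx A).

(** Polarization: [sq0] is expanded at [x + y]. *)
Lemma iota_anticomm x y : iota x * iota y = - (iota y * iota x).
Proof.
apply/eqP; rewrite -addr_eq0; have := sq0 (x + y).
by rewrite raddfD /= mulrDl !mulrDr !sq0 addr0 add0r => ->.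
Qed.

Lemma wedge_index_nil : W [::] = 1.
Proof. by rewrite /W /wedge_index /wedge big_nil. Qed.

Lemma wedge_index_cons t r : W (t :: r) = iota (tnth v t) * W r.
Proof. by rewrite /W /wedge_index /wedge big_cons. Qed.

Lemma wedge_index_cat r s : W (r ++ s) = W r * W s.
Proof. by rewrite /W /wedge_index /wedge map_cat big_cat. Qed.

Lemma iota_wedge_index t r :
  iota (tnth v t) * W r = (-1) ^+ size r *: (W r * iota (tnth v t)).
Proof.
elim: r => [|u r IHr]; first by rewrite wedge_index_nil mulr1 mul1r scale1r.
rewrite wedge_index_cons mulrA iota_anticomm mulNr -[X in - X]mulrA IHr /= exprS.
by rewrite mulN1r scaleNr -scalerAr mulrA.
Qed.

Lemma wedge_index_mem t r : t \in r -> iota (tnth v t) * W r = 0.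
Proof.
move=> /splitPr[r1 r2]; rewrite wedge_index_cat wedge_index_cons mulrA.
by rewrite iota_wedge_index -scalerAl mulrA -(mulrA (W r1)) sq0 mulr0 mul0r scaler0.
Qed.

Lemma wedge_index_dup r : ~~ uniq r -> W r = 0.
Proof.
elim: r => //= t r IHr; rewrite negb_and negbK wedge_index_cons.
by case/orP => [/wedge_index_mem //|/IHr ->]; rewrite mulr0.
Qed.

(** Induction on [r]: its first letter [t] splits [s] as [s1 ++ t :: s2]. Bringing [t] to the front
    of [s] costs [size s1] signs, and the induction hypothesis compares the tail of [r] with
    [s1 ++ s2]. *)
Lemma wedge_index_perm r s : uniq r -> perm_eq r s ->
  W r = (-1) ^+ (inversions r + inversions s) *: W s.
Proof.
elim: r s => [|t r IHr] s.
  by move=> _; rewrite perm_sym => /perm_nilP ->; rewrite scale1r.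
move=> /= /andP[tr ur] rs; have /splitPr ts : t \in s by rewrite -(perm_mem rs) mem_head.
case: ts rs => s1 s2; rewrite perm_sym -(cat1s t s2) perm_catCA perm_cons perm_sym cat1s => rs.
have t12 : t \notin s1 ++ s2 by rewrite -(perm_mem rs).
rewrite wedge_index_cons (IHr _ ur rs) -scalerAr !wedge_index_cat wedge_index_cons.
have -> : iota (tnth v t) * (W s1 * W s2) =
          (-1) ^+ size s1 *: (W s1 * (iota (tnth v t) * W s2)).
  by rewrite mulrA iota_wedge_index -scalerAl mulrA.
rewrite scalerA -exprD.
congr (_ *: _); apply: eq_signr.
rewrite !inversions_cat /= -(cat1s t s2) !num_gt_catr (num_gt_permr [:: t] rs) num_gt_catr.
have /num_gt_addC : [disjoint s1 & [:: t]].
  by rewrite disjoint_sym disjoint_has /= orbF; move: t12; rewrite mem_cat; case/norP.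
(* Once [size s1] is split into the two counts between [s1] and [t], the exponents differ by twice
   [num_gt [:: t] s2]; this even number is added on the left. *)
rewrite /= muln1 => <-; rewrite -[LHS]addbF -[false](odd_double (num_gt [:: t] s2)).
by rewrite -oddD; congr odd; lia.
Qed.

(** Increasing words have no inversions, so those of the concatenation are exactly the ones between
    its two halves. A shared index repeats a letter and kills the product. *)
Lemma wedge_indexM A B :
  V A * V B =
  ([disjoint A & B]%:R * (-1) ^+ num_gt (midx A) (midx B)) *: V (A :|: B).
Proof.
rewrite /V -wedge_index_cat; case: (boolP [disjoint A & B]) => [AB|nAB].
  rewrite (wedge_index_perm _ (perm_midxU AB)).
    by rewrite inversions_cat !inversions_midx addn0 mul1r.
  by rewrite (perm_uniq (perm_midxU AB)) enum_uniq.
rewrite mul0r scale0r; apply: wedge_index_dup; apply: contra nAB.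
rewrite cat_uniq => /and3P[_ /hasPn AB _]; rewrite disjoint_sym disjoint_subset.
by apply/subsetP => i iB; have := AB i; rewrite !mem_enum => /(_ iB).
Qed.

End WedgeIndex.

(** * Generation of the exterior algebra by its vectors *)

Section Subalgebra.
Variables (R : pzRingType) (E : algType R) (S : subalgClosed E).
(** The universal property quantifies over algebra types, so a closed predicate has to be turned
    into such a type. *)
Record subalgebra := Subalgebra { subalgebra_val : E; _ : subalgebra_val \in S }.
HB.instance Definition _ := [isSub for subalgebra_val].
HB.instance Definition _ := [Choice of subalgebra by <:].
HB.instance Definition _ := [SubChoice_isSubAlgebra of subalgebra by <:].
End Subalgebra.

Section Generation.
Variables (K : numFieldType) (X : vectType K) (E : algType K).
Variable iota : {linear X -> E}.
Hypothesis hE : is_exterior_algebra iota.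

(** The map [iota] corestricts to [S] and extends to a morphism [g] from [E] to [S]. Followed by the
    inclusion, [g] is an endomorphism of [E] that fixes every [iota x], hence the identity by
    uniqueness; so [z] is the value of [g z]. *)
Lemma exterior_algebra_generated (S : subalgClosed E) :
  (forall x, iota x \in S) -> forall z, z \in S.
Proof.
move=> SX z; have [sq0 univ] := hE.
pose f0 x : subalgebra S := Subalgebra (SX x).
have f0lin : linear f0 by move=> c x y; apply: val_inj; rewrite /= !linearP.
pose f : {linear X -> subalgebra S} :=
  HB.pack f0 (GRing.isLinear.Build K X (subalgebra S) *:%R f0 f0lin).
have [x|g [gf _]] := univ _ f; first by apply: val_inj; apply: sq0.
have [id0 [_ uniq_id]] := univ _ iota sq0.
pose h0 (y : E) : E := val (g y).
have h0lin : linear h0 by move=> c x y; rewrite /h0 !linearP.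
have h0mon : monoid_morphism h0 by split=> [|x y]; rewrite /h0 ?rmorph1 ?rmorphM.
pose h : {lrmorphism E -> E} := HB.pack h0
  (GRing.isLinear.Build K E E *:%R h0 h0lin) (GRing.isMonoidMorphism.Build E E h0 h0mon).
have hi x : h (iota x) = iota x by rewrite /= /h0 gf.
have <- : h z = z by rewrite (uniq_id h hi) -(uniq_id idfun).
exact: (valP (g z)).
Qed.

End Generation.

(** * Spans of basis wedges and parity of multivectors *)

Section Span.
Variables (K : numFieldType) (X : vectType K) (E : algType K).
Variables (iota : {linear X -> E}) (n : nat) (v : n.-tuple X).
Implicit Types (A B : {set 'I_n}) (P Q : pred {set 'I_n}).

Let V A := wedge_index iota v (midx A).

(** The predicate [P] allows a grade, a parity and the whole algebra to be treated alike. *)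
Definition in_span P (z : E) := exists c, z = \sum_(A | P A) c A *: V A.

Lemma in_span0 P : in_span P 0.
Proof. by exists (fun=> 0); rewrite big1 // => A _; rewrite scale0r. Qed.

Lemma in_spanD P y z : in_span P y -> in_span P z -> in_span P (y + z).
Proof.
move=> [c ->] [d ->]; exists (fun A => c A + d A).
by rewrite -big_split; apply: eq_bigr => A _; rewrite scalerDl.
Qed.

Lemma in_spanZ P c z : in_span P z -> in_span P (c *: z).
Proof.
move=> [d ->]; exists (fun A => c * d A).
by rewrite scaler_sumr; apply: eq_bigr => A _; rewrite scalerA.
Qed.

Lemma in_span_sum P (I : Type) (r : seq I) (p : pred I) (F : I -> E) :
  (forall i, p i -> in_span P (F i)) -> in_span P (\sum_(i <- r | p i) F i).
Proof. by move=> FP; elim/big_ind: _ => //; [exact: in_span0 | exact: in_spanD]. Qed.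

Lemma in_span_wedge_index P A : P A -> in_span P (V A).
Proof.
move=> PA; exists (fun B => (B == A)%:R).
rewrite (bigD1 A) //= eqxx scale1r big1 ?addr0 // => B /andP[_ /negbTE ->].
by rewrite scale0r.
Qed.

Hypothesis hE : is_exterior_algebra iota.
Hypothesis hv : basis_of fullv v.

(** Only disjoint pairs survive in a product. The resulting predicate keeps the disjointness so that
    cardinalities can be added later. *)
Lemma in_spanM P Q y z : in_span P y -> in_span Q z ->
  in_span (fun C => [exists A, exists B, [&& P A, Q B, [disjoint A & B] & C == A :|: B]])
    (y * z).
Proof.
move=> [c ->] [d ->]; rewrite mulr_suml; apply: in_span_sum => A PA.
rewrite mulr_sumr; apply: in_span_sum => B QB.
rewrite -scalerAl -scalerAr; do 2 apply: in_spanZ.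
rewrite (wedge_indexM _ hE.1); case: (boolP [disjoint A & B]) => [AB|_].
  apply: in_spanZ; apply: in_span_wedge_index.
  by apply/existsP; exists A; apply/existsP; exists B; rewrite PA QB AB eqxx.
by rewrite mul0r scale0r; apply: in_span0.
Qed.

Lemma in_span_sub P Q z : (forall A, P A -> Q A) -> in_span P z -> in_span Q z.
Proof.
by move=> PQ [c ->]; apply: in_span_sum => A /PQ QA; apply/in_spanZ/in_span_wedge_index.
Qed.

Lemma in_span_iota x : in_span (fun A => #|A| == 1)%N (iota x).
Proof.
rewrite (coord_basis hv (memvf x)) linear_sum; apply: in_span_sum => i _.
rewrite linearZ; apply: in_spanZ.
have -> : iota v`_i = V [set i].
  by rewrite /V /midx enum_set1 /wedge_index /wedge big_seq1 (tnth_nth 0).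
by apply: in_span_wedge_index; rewrite cards1.
Qed.

Lemma in_span1 : in_span (fun A => #|A| == 0)%N 1.
Proof.
have -> : 1 = V set0 by rewrite /V /midx enum_set0 wedge_index_nil.
by apply: in_span_wedge_index; rewrite cards0.
Qed.

(** The span contains 1 and all vectors and is closed under products, so it is a subalgebra to which
    generation applies. *)
Lemma in_spanT z : in_span xpredT z.
Proof.
pose S := [pred z : E | `[< in_span xpredT z >]].
have closS : GRing.subsemialg_closed S.
  split=> [||c y|y t]; rewrite ?inE.
  - by apply/asboolP; apply: in_span_sub in_span1.
  - split; first by apply/asboolP; apply: in_span0.
    by move=> y t /asboolP yS /asboolP tS; apply/asboolP; apply: in_spanD.
  - by move=> /asboolP yS; apply/asboolP; apply: in_spanZ.
  move=> /asboolP yS /asboolP tS; apply/asboolP.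
  by apply: in_span_sub (in_spanM yS tS).
pose S' : subalgClosed E := HB.pack (S : E -> bool) (GRing.isSubalgClosed.Build K E S closS).
have /asboolP // : z \in S'.
apply: (exterior_algebra_generated hE) => x.
by apply/asboolP; apply: in_span_sub (in_span_iota x).
Qed.

Lemma in_span_wedge (s : seq X) : in_span (fun A => #|A| == size s) (wedge iota s).
Proof.
elim: s => [|x s IHs]; first by rewrite /wedge big_nil; apply: in_span1.
rewrite /wedge big_cons; apply: in_span_sub (in_spanM (in_span_iota x) IHs) => C.
case/existsP=> A /existsP[B /and4P[/eqP A1 /eqP Bs AB /eqP ->]].
by rewrite cardsU A1 Bs (disjoint_setI0 AB) cards0 subn0.
Qed.

(** Replaces sums of wedges of arbitrary vectors by coordinates on basis wedges, where parity is
    that of a cardinality. *)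
Lemma has_grade_parityP b z :
  has_grade_parity iota b z <-> in_span (fun A => odd #|A| == b) z.
Proof.
split=> [[m [c [s [sb ->]]]]|[c ->]].
  apply: in_span_sum => i _; apply: in_spanZ.
  by apply: in_span_sub (in_span_wedge (s i)) => A /eqP ->; rewrite sb.
exists #|[pred A : {set 'I_n} | odd #|A| == b]|, (fun i => c (enum_val i)).
exists (fun i => [seq tnth v t | t <- midx (enum_val i)]); split=> [i|].
  by rewrite size_map -cardE; apply/eqP; apply: (enum_valP i).
by rewrite big_enum_val.
Qed.

End Span.

(** * Orthonormal families and inner products *)

Lemma orthonormal_nth (R : nzRingType) (eps : bool) (theta : {rmorphism R -> R})
    (U : lmodType R) (form : {hermitian U for eps & theta}) (s : seq U) p q :
  orthonormal form s -> (p < size s)%N -> (q < size s)%N ->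
  form s`_p s`_q = (p == q)%:R.
Proof.
rewrite /orthonormal; elim: s p q => //= x s IHs p q.
case/andP=> /andP[/eqP x1 s1] /andP[]; rewrite andbT => /allP xs srec.
have ox y : y \in s -> form x y = 0 by move=> ys; apply/eqP/xs.
case: p q => [|p] [|q]; rewrite ?ltnS => ps qs /=.
- by [].
- by rewrite ox // mem_nth.
(* The definition of [orthonormal] compares an entry only with later ones; the opposite order comes
   from hermitian symmetry. *)
- by rewrite hermC ox ?mem_nth // rmorph0 mulr0.
- by rewrite IHs // s1.
Qed.

Section Inner.
Variables (K : numFieldType) (theta : {rmorphism K -> K}) (U : lmodType K).
Variable dot : {dot U for theta}.
Implicit Types x y z : U.

(** Since [inner] swaps the arguments of the form, linearity in its second argument is left
    linearity of [dot]. *)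
Lemma innerB x y z : inner dot x (y - z) = inner dot x y - inner dot x z.
Proof. exact: linearBl. Qed.

Lemma innerZ c x y : inner dot x (c *: y) = c * inner dot x y.
Proof. exact: linearZl. Qed.

Lemma innerZl c x y : inner dot (c *: x) y = theta c * inner dot x y.
Proof. exact: linearZr. Qed.

Lemma inner_sum (I : Type) (r : seq I) (P : pred I) x (F : I -> U) :
  inner dot x (\sum_(t <- r | P t) F t) = \sum_(t <- r | P t) inner dot x (F t).
Proof. exact: linear_sumlz. Qed.

Lemma inner_suml (I : Type) (r : seq I) (P : pred I) x (F : I -> U) :
  inner dot (\sum_(t <- r | P t) F t) x = \sum_(t <- r | P t) inner dot (F t) x.
Proof. exact: linear_sumr. Qed.

Lemma inner_eq0 x : (inner dot x x == 0) = (x == 0).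
Proof.
apply/eqP/eqP => [xx|->]; last exact: linear0l.
apply/eqP/negPn/negP => /(neq0_dnorm_gt0 (s := dot)).
by rewrite -/(inner dot x x) xx Order.POrderTheory.ltxx.
Qed.

End Inner.

(** * Orthonormality of basis wedges, contraction, and parity of the operators *)

Section Contraction.
Variables (K : numFieldType) (theta : {rmorphism K -> K}).
Variables (X : vectType K) (dotX : {dot X for theta}) (E : algType K).
Variables (iota : {linear X -> E}) (dotE : {dot E for theta}).
Variables (lctr : E -> E -> E) (n : nat) (v : n.-tuple X).
Hypothesis hE : is_exterior_algebra iota.
Hypothesis hdotE : is_induced_dot iota dotX dotE.
Hypothesis hlctr : is_left_contraction dotE lctr.
Hypothesis hv : basis_of fullv v.
Hypothesis horth : orthonormal dotX v.
Implicit Types (A B I J : {set 'I_n}) (L M N : E).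

Let V A := wedge_index iota v (midx A).

(** Different sizes give different grades. For equal sizes the value is a Gram determinant: the
    identity matrix if [A = B], and otherwise a matrix whose row at some [i0] in [A] but not in [B]
    vanishes. *)
Lemma inner_wedge_index A B : inner dotE (V A) (V B) = (A == B)%:R.
Proof.
have sizeV C : size [seq tnth v t | t <- midx C] = #|C| by rewrite size_map -cardE.
have [hdotn hdotp] := hdotE.
case: (eqVneq #|A| #|B|) => [cAB|cAB]; last first.
  rewrite (_ : A == B = false); last by apply: contraNF cAB => /eqP ->.
  by apply: (hdotn _ _ (in_tuple _) (in_tuple _)); rewrite !sizeV.
have tA : size [seq tnth v t | t <- midx A] == #|A| by rewrite sizeV.
have tB : size [seq tnth v t | t <- midx B] == #|A| by rewrite sizeV cAB.
have := hdotp _ (Tuple tA) (Tuple tB); rewrite /V /wedge_index => -> /=.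
have sA : size (midx A) = #|A| by rewrite -cardE.
have sB : size (midx B) = #|A| by rewrite cAB -cardE.
have entry (r s : 'I_#|A|) (i0 : 'I_n) :
    inner dotX (tnth (Tuple tA) r) (tnth (Tuple tB) s) =
    (nth i0 (midx A) r == nth i0 (midx B) s)%:R.
  rewrite !(tnth_nth 0) /= !(nth_map i0) ?sA ?sB ?ltn_ord // !(tnth_nth 0).
  by rewrite /inner orthonormal_nth ?size_tuple ?ltn_ord // eq_sym.
case: (eqVneq A B) => [AB|nAB].
  rewrite (_ : \matrix_(_, _) _ = 1%:M) ?det1 //.
  apply/matrixP => r s; rewrite !mxE.
  (* The default index for [nth] has to be an element of ['I_n]; the row index [r] supplies one. *)
  by rewrite (entry _ _ (enum_val r)) -AB nth_uniq ?sA // enum_uniq.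
have [i0 iA iB] : exists2 i0, i0 \in A & i0 \notin B.
  apply/subsetPn; apply: contra nAB => AB; rewrite eqEcard AB cAB leqnn //.
have iAr : (index i0 (midx A) < #|A|)%N by rewrite -sA index_mem mem_enum.
rewrite (expand_det_row _ (Ordinal iAr)) big1 // => s _; rewrite mxE (entry _ _ i0).
rewrite nth_index ?mem_enum //= (_ : _ == _ = false) ?mul0r //.
apply/negbTE; apply: contra iB => /eqP ->; rewrite -mem_enum.
by apply: mem_nth; rewrite sB.
Qed.

Lemma wedge_index_neq0 A : V A != 0.
Proof. by rewrite -(inner_eq0 dotE) inner_wedge_index eqxx oner_eq0. Qed.

Lemma inner_ext M N : (forall L, inner dotE L M = inner dotE L N) -> M = N.
Proof.
move=> MN; apply/eqP; rewrite -subr_eq0 -(inner_eq0 dotE) innerB.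
by rewrite MN subrr.
Qed.

(** Contraction is given only by its adjunction, so linearity is obtained by pairing with every
    [L]. *)
Lemma lctr_sum (I : finType) (P : pred I) M (c : I -> K) (F : I -> E) :
  lctr M (\sum_(t | P t) c t *: F t) = \sum_(t | P t) c t *: lctr M (F t).
Proof.
apply: inner_ext => L; rewrite hlctr !inner_sum.
by apply: eq_bigr => t _; rewrite !innerZ hlctr.
Qed.

Lemma inner_ext_basis M N :
  (forall A, inner dotE (V A) M = inner dotE (V A) N) -> M = N.
Proof.
move=> MN; apply: inner_ext => L; have [c ->] := in_spanT hE hv L.
by rewrite !inner_suml; apply: eq_bigr => A _; rewrite !innerZl MN.
Qed.

(** Paired with [V A], the left side is the inner product of [V J * V A] with [V B]. By [UB] it is
    nonzero exactly when [J] lies in [B] and [A] is [B :\: J]; [theta] fixes the sign. *)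
Lemma lctr_wedge_index J B : lctr (V J) (V B) =
  ((J \subset B)%:R * (-1) ^+ num_gt (midx J) (midx (B :\: J))) *: V (B :\: J).
Proof.
apply: inner_ext_basis => A; rewrite hlctr (wedge_indexM _ hE.1).
rewrite innerZl innerZ rmorphM rmorph_nat rmorph_sign !inner_wedge_index.
have UB : (J :|: A == B) && [disjoint J & A] = (J \subset B) && (A == B :\: J).
  apply/andP/andP => [[/eqP <- JA]|[JB /eqP ->]].
    by rewrite subsetUl setDUl setDv set0U (setDidPl _) // disjoint_sym.
  rewrite -{1}(setIidPr JB) setID eqxx disjoints_subset.
  by split=> //; apply/subsetP => i iJ; rewrite !inE iJ.
case: (eqVneq A (B :\: J)) UB => [->|_]; rewrite ?andbT ?andbF.
  case: (J \subset B) => [/andP[-> ->] //|]; rewrite mul0r mul0r.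
  by case: (_ == B); rewrite ?mulr0 //= => ->; rewrite !mul0r.
by rewrite mulr0; case: (_ == B); rewrite ?mulr0 //= => ->; rewrite !mul0r.
Qed.

Lemma has_grade_parity_wedge_index A : has_grade_parity iota (odd #|A|) (V A).
Proof. exact/(has_grade_parityP hE hv)/in_span_wedge_index. Qed.

(** Even and odd parts are orthogonal, so such an [M] is orthogonal to itself. *)
Lemma has_grade_parity_uniq b M :
  has_grade_parity iota b M -> has_grade_parity iota (~~ b) M -> M = 0.
Proof.
move=> /(has_grade_parityP hE hv)[c Mc] /(has_grade_parityP hE hv)[d Md].
apply/eqP; rewrite -(inner_eq0 dotE) {1}Mc Md; apply/eqP.
rewrite inner_suml big1 // => A /eqP Ab; rewrite inner_sum big1 // => B /eqP Bb.
rewrite innerZl innerZ inner_wedge_index (_ : A == B = false) ?mulr0 //.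
by apply/eqP => AB; move: Ab; rewrite AB Bb; case: (b).
Qed.

(** A nonzero image of a homogeneous element prevents a parity-preserving operator from also
    switching parity, which settles the truth value in [op_parity]. *)
Lemma op_parity_homogeneous (T : E -> E) p M b :
  (forall b N, has_grade_parity iota b N -> has_grade_parity iota (p (+) b) (T N)) ->
  has_grade_parity iota b M -> T M <> 0 -> op_parity iota T = p.
Proof.
move=> Tp Mb TM0; rewrite /op_parity; congr nat_of_bool; case: p Tp => Tp.
  by apply/asboolP => c N; apply: Tp.
apply/asboolP => Tsw; apply: TM0; apply: has_grade_parity_uniq (Tp _ _ Mb) _.
exact: Tsw.
Qed.

Lemma op_parity_creation I : op_parity iota (creation iota v (midx I)) = odd #|I|.
Proof.
have V1 : has_grade_parity iota false 1.
  by exists 1%N, (fun=> 1), (fun=> [::]); rewrite big_ord1 scale1r /wedge big_nil.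
(* The nonzero value is the image of 1, namely [V I]. *)
apply: (op_parity_homogeneous _ V1) => [b N /(has_grade_parityP hE hv) Nb|].
  have /(has_grade_parityP hE hv) Ib := has_grade_parity_wedge_index I.
  apply/(has_grade_parityP hE hv); apply: in_span_sub (in_spanM hE Ib Nb) => C.
  case/existsP=> A /existsP[B /and4P[/eqP <- /eqP <- AB /eqP ->]].
  by rewrite cardsU (disjoint_setI0 AB) cards0 subn0 oddD.
by rewrite /creation mulr1; apply/eqP/wedge_index_neq0.
Qed.

Lemma op_parity_annihilation J :
  op_parity iota (annihilation iota v lctr (midx J)) = odd #|J|.
Proof.
(* The nonzero value is the contraction of [V J] by itself, a sign times [V set0]. *)
apply: (op_parity_homogeneous _ (has_grade_parity_wedge_index J)) => [b N|].
  move=> /(has_grade_parityP hE hv)[c ->]; apply/(has_grade_parityP hE hv).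
  rewrite /annihilation lctr_sum; apply: in_span_sum => A /eqP Ab.
  apply: in_spanZ; rewrite lctr_wedge_index; case: (boolP (J \subset A)) => [JA|_].
    apply/in_spanZ/in_span_wedge_index.
    by rewrite cardsD (setIidPr JA) oddB ?subset_leq_card // Ab addbC.
  by rewrite mul0r scale0r; apply: in_span0.
rewrite /annihilation lctr_wedge_index subxx setDv mul1r; apply/eqP.
by rewrite scaler_eq0 signr_eq0 wedge_index_neq0.
Qed.

End Contraction.

(** * Sign rules and Boolean identities between three sets *)

Section Signs.
Variable n : nat.
Implicit Types A B C : {set 'I_n}.

Lemma midx_eq0 A : (midx A == [::]) = (A == set0).
Proof. by rewrite -size_eq0 -cardE cards_eq0. Qed.

Lemma num_gtUl A B C : [disjoint A & B] ->
  num_gt (midx (A :|: B)) (midx C) = (num_gt (midx A) (midx C) + num_gt (midx B) (midx C))%N.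
Proof. by move=> /perm_midxU AB; rewrite -(num_gt_perml _ AB) num_gt_catl. Qed.

Lemma num_gtUr A B C : [disjoint B & C] ->
  num_gt (midx A) (midx (B :|: C)) = (num_gt (midx A) (midx B) + num_gt (midx A) (midx C))%N.
Proof. by move=> /perm_midxU BC; rewrite -(num_gt_permr _ BC) num_gt_catr. Qed.

Lemma odd_num_gtC A B : [disjoint A & B] ->
  odd (num_gt (midx B) (midx A)) = (odd #|A| && odd #|B|) (+) odd (num_gt (midx A) (midx B)).
Proof.
move=> AB; have : [disjoint midx A & midx B].
  by rewrite (eq_disjoint (mem_enum A)) (eq_disjoint_r (mem_enum B)).
by move/num_gt_addC/(congr1 odd); rewrite oddD oddM -!cardE => <-; rewrite addbC addKb.
Qed.

End Signs.

(** Pointwise check over the eight membership patterns in [i], [j], [k]; emptiness hypotheses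
    exclude some of them. *)
Ltac set_tauto i j k :=
  let t := fresh "t" in
  apply/setP; intro t;
  repeat match goal with H : _ = set0 |- _ => move/setP/(_ t): H end;
  rewrite !inE;
  by case: (t \in i); case: (t \in j); case: (t \in k).

Ltac disjoint_tauto i j k := rewrite -setI_eq0; apply/eqP; set_tauto i j k.

(** * The two terms of the supercommutator and their difference *)

Section Supercommutator.
Variables (K : numFieldType) (theta : {rmorphism K -> K}).
Variables (X : vectType K) (dotX : {dot X for theta}) (E : algType K).
Variables (iota : {linear X -> E}) (dotE : {dot E for theta}).
Variables (lctr : E -> E -> E) (n : nat) (v : n.-tuple X).
Hypothesis hE : is_exterior_algebra iota.
Hypothesis hdotE : is_induced_dot iota dotX dotE.
Hypothesis hlctr : is_left_contraction dotE lctr.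
Hypothesis hv : basis_of fullv v.
Hypothesis horth : orthonormal dotX v.
Variables (i j k : {set 'I_n}).

Let a := i :\: (j :|: k).
Let b := (j :&: k) :\: i.
Let c := i :&: j :&: k.
Let d := (i :&: j) :\: k.
Let e := k :\: (i :|: j).
Let x := j :\: (i :|: k).
Let y := (i :&: k) :\: j.
Let V A := wedge_index iota v (midx A).
Let sign : K := (-1) ^+ (size (midx d) + num_gt (midx a ++ midx b) (midx d ++ midx e)).

Lemma reorder_ace : reorder (midx a ++ midx c ++ midx e) = midx (a :|: (c :|: e)).
Proof.
apply: reorder_midx; have ce : [disjoint c & e] by disjoint_tauto i j k.
have ace : [disjoint a & c :|: e] by disjoint_tauto i j k.
by rewrite -(permPr (perm_midxU ace)) perm_cat2l; apply: perm_midxU.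
Qed.

Lemma creation_annihilation :
  creation iota v (midx i) (annihilation iota v lctr (midx j) (V k)) =
  (((x == set0) && (y == set0) && (d == set0))%:R * sign) *: V (a :|: (c :|: e)).
Proof.
rewrite /creation /annihilation (lctr_wedge_index hE hdotE hlctr hv horth).
rewrite -scalerAr (wedge_indexM _ hE.1) scalerA.
have -> : (j \subset k) = (x == set0) && (d == set0).
  by rewrite -setU_eq0 -setD_eq0; congr (_ == _); set_tauto i j k.
have -> : [disjoint i & k :\: j] = (y == set0).
  by rewrite -setI_eq0; congr (_ == _); set_tauto i j k.
case: (eqVneq x set0) => [x0|_] /=; last by rewrite !mul0r !scale0r.
case: (eqVneq d set0) => [d0|_] /=; last by rewrite andbF !mul0r !scale0r.
case: (eqVneq y set0) => [y0|_] /=; last by rewrite !(mul0r, mulr0) !scale0r.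
have ac : [disjoint a & c] by disjoint_tauto i j k.
have bc : [disjoint b & c] by disjoint_tauto i j k.
have kjE : k :\: j = e by set_tauto i j k.
have iE : i = a :|: c by set_tauto i j k.
have jE : j = b :|: c by set_tauto i j k.
have -> : i :|: k :\: j = a :|: (c :|: e) by set_tauto i j k.
congr (_ *: _); rewrite !mul1r -exprD /sign kjE d0 /midx enum_set0 /= -!/(midx _).
rewrite num_gt_catl iE jE !num_gtUl //; apply: eq_signr.
(* The pairs between [c] and [e] are counted twice on the left, once through [i] and once through
   [j]. *)
rewrite -[RHS]addbF -[false](odd_double (num_gt (midx c) (midx e))) -oddD.
by congr odd; lia.
Qed.

Lemma annihilation_creation :
  (-1) ^+ (odd #|i| * odd #|j|) *:
    annihilation iota v lctr (midx j) (creation iota v (midx i) (V k)) =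
  (((x == set0) && (y == set0) && (c == set0))%:R * sign) *: V (a :|: (c :|: e)).
Proof.
(* Homogeneity is [lctr_sum] for a sum with a single term. *)
have lctrZ s M N : lctr M (s *: N) = s *: lctr M N.
  by have := lctr_sum hlctr xpredT M (fun _ : 'I_1 => s) (fun=> N); rewrite !big_ord1.
rewrite /creation /annihilation (wedge_indexM _ hE.1) lctrZ.
rewrite (lctr_wedge_index hE hdotE hlctr hv horth) !scalerA.
have -> : (j \subset i :|: k) = (x == set0) by rewrite -setD_eq0.
have -> : [disjoint i & k] = (y == set0) && (c == set0).
  by rewrite -setU_eq0 -setI_eq0; congr (_ == _); set_tauto i j k.
case: (eqVneq x set0) => [x0|_] /=; last by rewrite !(mul0r, mulr0) !scale0r.
case: (eqVneq y set0) => [y0|_] /=; last by rewrite !(mul0r, mulr0) !scale0r.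
case: (eqVneq c set0) => [c0|_] /=; last by rewrite !(mul0r, mulr0) !scale0r.
have ab : [disjoint a & b] by disjoint_tauto i j k.
have ad : [disjoint a & d] by disjoint_tauto i j k.
have bd : [disjoint b & d] by disjoint_tauto i j k.
have ae : [disjoint a & e] by disjoint_tauto i j k.
have be : [disjoint b & e] by disjoint_tauto i j k.
have restE : (i :|: k) :\: j = a :|: e by set_tauto i j k.
have iE : i = a :|: d by set_tauto i j k.
have jE : j = b :|: d by set_tauto i j k.
have kE : k = b :|: e by set_tauto i j k.
have cardU (A B : {set 'I_n}) : [disjoint A & B] -> #|A :|: B| = (#|A| + #|B|)%N.
  by move=> AB; rewrite cardsU (disjoint_setI0 AB) cards0 subn0.
rewrite restE c0 set0U; congr (_ *: _); rewrite !mul1r -!exprD /sign.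
apply: eq_signr; rewrite num_gt_catl !num_gt_catr -cardE.
rewrite iE jE kE !cardU // !num_gtUl // !num_gtUr // !(oddD, oddM, oddb).
(* Reversing these three counts produces products of cardinalities that cancel against [#|i| * #|j|]
   except for [#|d| * #|d|], which has the parity of [#|d|]. The count of [d] against [e] occurs
   twice. *)
rewrite (odd_num_gtC ab) (odd_num_gtC bd) (odd_num_gtC ad).
by case: (odd #|a|); case: (odd #|b|); case: (odd #|d|); do 6!case: (odd (num_gt _ _)).
Qed.

(** Both terms share [sign], the vector and the condition on [x] and [y], so only the indicators of
    [d] and [c] are subtracted. *)
Lemma supercommutator_wedge_index :
  supercommutator iota
      (creation iota v (midx i)) (annihilation iota v lctr (midx j)) (V k) =
  ((midx x ++ midx y == [::])%:R * ((midx d == [::])%:R - (midx c == [::])%:R) * sign)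
    *: wedge_index iota v (reorder (midx a ++ midx c ++ midx e)).
Proof.
rewrite /supercommutator (op_parity_creation hE hdotE hv horth).
rewrite (op_parity_annihilation hE hdotE hlctr hv horth).
rewrite creation_annihilation annihilation_creation reorder_ace -scalerBl.
have -> : (midx x ++ midx y == [::]) = (x == set0) && (y == set0).
  by rewrite -!midx_eq0; case: (midx x) => // ? ?.
rewrite !midx_eq0 -mulrBl; congr (_ * _ *: _).
by rewrite -!mulnb !natrM mulrBr.
Qed.

End Supercommutator.

Theorem theorem5p18 (R : realType) (kind : space_kind)
    (X : vectType (space_field R kind)) (dotX : {dot X for space_conj R kind})
    (E : algType (space_field R kind)) (iota : {linear X -> E})
    (hE : is_exterior_algebra iota)
    (dotE : {dot E for space_conj R kind})
    (hdotE : is_induced_dot iota dotX dotE)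
    (lctr : E -> E -> E) (hlctr : is_left_contraction dotE lctr)
    (n : nat) (v : n.-tuple X)
    (hbasis : basis_of fullv v) (horth : orthonormal dotX v)
    (i j k : {set 'I_n}) :
  let a := midx (i :\: (j :|: k)) in
  let b := midx ((j :&: k) :\: i) in
  let c := midx (i :&: j :&: k) in
  let d := midx ((i :&: j) :\: k) in
  let e := midx (k :\: (i :|: j)) in
  let x := midx (j :\: (i :|: k)) in
  let y := midx ((i :&: k) :\: j) in
  supercommutator iota
      (creation iota v (midx i)) (annihilation iota v lctr (midx j))
      (wedge_index iota v (midx k)) =
    ((x ++ y == [::])%:R * ((d == [::])%:R - (c == [::])%:R)
       * (-1) ^+ (size d + num_gt (a ++ b) (d ++ e)))
      *: wedge_index iota v (reorder (a ++ c ++ e)).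
Proof.
(* Both kinds of space are instances of the computation over a general [K] and [theta]. *)
by move=> *; apply: supercommutator_wedge_index hE hdotE hlctr hbasis horth _ _ _.
Qed.
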